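(* Let $X$ be a $W$-hyperbolic space, $C\subseteq X$ a nonempty convex subset, and $T,U:C\to C$ nonexpansive mappings with $Fix(T)\cap Fix(U)\neq\emptyset$. Let $x_0,u\in C$, let $(\alpha_n)_{n\in\mathbb N},(\beta_n)_{n\in\mathbb N}$ be sequences in $[0,1]$, and let $(x_n),(y_n)$ be the alternating Halpern-Mann iteration: for all $n\in\mathbb N$, $y_n=(1-\alpha_n)Tx_n+\alpha_n u$ and $x_{n+1}=(1-\beta_n)Uy_n+\beta_n y_n$. Let $p\in Fix(T)\cap Fix(U)$, $M_p=\max\{d(x_0,p),d(u,p)\}$, and let $K\in\mathbb N$, $K\geq 1$, satisfy $K\geq M_p$. Assume that - $\sum_{n=0}^\infty\alpha_n$ diverges with rate of divergence $\sigma_2:\mathbb N\to\mathbb N$; - $\sum_{n=0}^\infty|\alpha_{n+1}-\alpha_n|$ converges with Cauchy modulus $\sigma_3:\mathbb N\to\mathbb N$; - $\sum_{n=0}^\infty|\beta_{n+1}-\beta_n|$ converges with Cauchy modulus $\sigma_4:\mathbb N\to\mathbb N$. Define $\chi:\mathbb N\to\mathbb N$ by $\chi(k)=\max\{\sigma_3(4K(k+1)-1),\sigma_4(4K(k+1)-1)\}$. Then: (i) $(x_n)$ is asymptotically regular with rate $\Gamma_1(k)=\sigma_2\big(\chi(2k+1)+2+\lceil\ln(4K(k+1))\rceil\big)+1$. (ii) $(y_n)$ is asymptotically regular with rate $\Gamma_2(k)=\max\{\Gamma_1(2k+1),\ \sigma_3(4K(k+1)-1)+1\}$.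
   Context: $\mathbb N=\{0,1,2,\dots\}$. A $W$-hyperbolic space is a metric space $(X,d)$ with a function $W:X\times X\times[0,1]\to X$, where $(1-\lambda)x+\lambda y$ denotes $W(x,y,\lambda)$, such that for all $x,y,w,z\in X$ and $\lambda,\tilde\lambda\in[0,1]$: (W1) $d(z,(1-\lambda)x+\lambda y)\le(1-\lambda)d(z,x)+\lambda d(z,y)$; (W2) $d((1-\lambda)x+\lambda y,(1-\tilde\lambda)x+\tilde\lambda y)=|\lambda-\tilde\lambda|d(x,y)$; (W3) $(1-\lambda)x+\lambda y=\lambda y+(1-\lambda)x$, i.e. $W(x,y,\lambda)=W(y,x,1-\lambda)$; (W4) $d((1-\lambda)x+\lambda z,(1-\lambda)y+\lambda w)\le(1-\lambda)d(x,y)+\lambda d(z,w)$. A nonempty $C\subseteq X$ is convex if $(1-\lambda)x+\lambda y\in C$ for all $x,y\in C$, $\lambda\in[0,1]$. A mapping $S:C\to C$ is nonexpansive if $d(Sx,Sy)\le d(x,y)$ for all $x,y\in C$; $Fix(S)$ is its set of fixed points. $\varphi:\mathbb N\to\mathbb N$ is a rate of convergence of $(a_n)$ towards $a$ if for all $k\in\mathbb N$ and $n\geq\varphi(k)$, $d(a_n,a)\le\frac1{k+1}$. $\varphi$ is a Cauchy modulus of $(a_n)$ if for all $k$, all $n\ge\varphi(k)$ and all $q\in\mathbb N$, $d(a_{n+q},a_n)\le\frac1{k+1}$; a Cauchy modulus of a series is a Cauchy modulus of the sequence $\left(\sum_{i=0}^n b_i\right)_n$ of partial sums. A series $\sum b_n$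 of nonnegative reals diverges with rate of divergence $\theta:\mathbb N\to\mathbb N$ if $\sum_{i=0}^{\theta(n)}b_i\ge n$ for all $n\in\mathbb N$. A sequence $(z_n)$ is asymptotically regular with rate $\varphi$ if $\varphi$ is a rate of convergence of $(d(z_n,z_{n+1}))$ towards $0$. *)

(* Defs.v *)
From Stdlib Require Import Reals ZArith.
From Stdlib Require Import Zfloor.
Open Scope R_scope.

Coercion Base : Metric_Space >-> Sortclass.
Arguments dist {_} _ _.

(* [W x y l] is (1-l)x + l y. It is a total function of [l : R], but it is only
   constrained on the interval [0,1]. *)
Record W_hyperbolic_space : Type := {
  WH_metric :> Metric_Space;
  W : WH_metric -> WH_metric -> R -> WH_metric;
  W1 : forall (x y z : WH_metric) (l : R), 0 <= l <= 1 ->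
    dist z (W x y l) <= (1 - l) * dist z x + l * dist z y;
  W2 : forall (x y : WH_metric) (l l' : R), 0 <= l <= 1 -> 0 <= l' <= 1 ->
    dist (W x y l) (W x y l') = Rabs (l - l') * dist x y;
  W3 : forall (x y : WH_metric) (l : R), 0 <= l <= 1 ->
    W x y l = W y x (1 - l);
  W4 : forall (x y z w : WH_metric) (l : R), 0 <= l <= 1 ->
    dist (W x z l) (W y w l) <= (1 - l) * dist x y + l * dist z w
}.
Arguments W {_} _ _ _.

Definition convex {X : W_hyperbolic_space} (C : X -> Prop) : Prop :=
  forall (x y : X) (l : R), C x -> C y -> 0 <= l <= 1 -> C (W x y l).

(* A self-mapping of C is represented by a total function on X that sends C
   into C; its values outside C are irrelevant. *)
Definition maps_into {X : Type} (C : X -> Prop) (S : X -> X) : Prop :=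
  forall x : X, C x -> C (S x).

Definition nonexpansive_on {X : Metric_Space} (C : X -> Prop) (S : X -> X) : Prop :=
  forall x y : X, C x -> C y -> dist (S x) (S y) <= dist x y.

Definition Fix_on {X : Type} (C : X -> Prop) (S : X -> X) (p : X) : Prop :=
  C p /\ S p = p.

Definition rate_of_convergence {X : Metric_Space}
    (a : nat -> X) (l : X) (phi : nat -> nat) : Prop :=
  forall k n : nat, (phi k <= n)%nat -> dist (a n) l <= / (INR k + 1).

Definition Cauchy_modulus {X : Metric_Space}
    (a : nat -> X) (phi : nat -> nat) : Prop :=
  forall k n q : nat, (phi k <= n)%nat -> dist (a (n + q)%nat) (a n) <= / (INR k + 1).

(* [sum_f_R0 b n] is b 0 + ... + b n, with n + 1 terms. *)
Definition series_Cauchy_modulus (b : nat -> R) (phi : nat -> nat) : Prop :=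
  @Cauchy_modulus R_met (fun n => sum_f_R0 b n) phi.

Definition rate_of_divergence (b : nat -> R) (theta : nat -> nat) : Prop :=
  forall n : nat, sum_f_R0 b (theta n) >= INR n.

Definition asymptotically_regular_with_rate {X : Metric_Space}
    (z : nat -> X) (phi : nat -> nat) : Prop :=
  @rate_of_convergence R_met (fun n => dist (z n) (z (S n))) 0 phi.

Definition alternating_Halpern_Mann {X : W_hyperbolic_space} (T U : X -> X)
    (x0 u : X) (alpha beta : nat -> R) (x y : nat -> X) : Prop :=
  x 0%nat = x0 /\
  (forall n : nat, y n = W (T (x n)) u (alpha n)) /\
  (forall n : nat, x (S n) = W (U (y n)) (y n) (beta n)).

(* The truncated subtraction below and the conversion [Z.to_nat] in [Gamma1]
   lose nothing when K >= 1: then 4K(k+1) >= 4, so its logarithm is positive. *)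
Definition chi (K : nat) (sigma3 sigma4 : nat -> nat) (k : nat) : nat :=
  Nat.max (sigma3 (4 * K * (k + 1) - 1)%nat) (sigma4 (4 * K * (k + 1) - 1)%nat).

Definition Gamma1 (K : nat) (sigma2 sigma3 sigma4 : nat -> nat) (k : nat) : nat :=
  (sigma2 (chi K sigma3 sigma4 (2 * k + 1) + 2
           + Z.to_nat (Zceil (ln (INR (4 * K * (k + 1)))))) + 1)%nat.

Definition Gamma2 (K : nat) (sigma2 sigma3 sigma4 : nat -> nat) (k : nat) : nat :=
  Nat.max (Gamma1 K sigma2 sigma3 sigma4 (2 * k + 1))
          (sigma3 (4 * K * (k + 1) - 1) + 1)%nat.

(* Main.v *)
(** Write s_n = d(x_n, x_{n+1}). Nonexpansiveness with (W2) and (W4) gives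
    s_{n+1} <= (1 - alpha_{n+1}) s_n + c_n with
    c_n = 2K (|alpha_{n+1} - alpha_n| + |beta_{n+1} - beta_n|).
    Unfolding this from the index chi(2k+1) + 1 and using 1 - a <= exp(-a), s_n is
    at most 2K exp(-sum alpha_i) plus a tail of the series of the c_i. The tail is
    at most 1/(2(k+1)) by the choice of chi, and the exponential term is so as
    soon as the sum of the alpha_i exceeds ln(4K(k+1)). *)
Require Import Defs.
From Stdlib Require Import Reals ZArith Zfloor Lra Lia.
Open Scope R_scope.

(** * Distance estimates for convex combinations *)

Section Distances.
Context {X : W_hyperbolic_space}.

Lemma dist_W_le (x y z : X) (l r : R) :
  0 <= l <= 1 -> dist x z <= r -> dist y z <= r -> dist (W x y l) z <= r.
Proof.
  intros Hl Hx Hy.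
  pose proof (W1 X x y z l Hl) as H.
  rewrite (dist_sym _ (W x y l) z).
  rewrite (dist_sym _ z x), (dist_sym _ z y) in H.
  nra.
Qed.

(** Pass through the intermediate point [W x y l']: (W2) pays for the change of parameter, (W4) for
    the change of endpoints. *)
Lemma dist_W_params (x y x' y' : X) (l l' r : R) :
  0 <= l <= 1 -> 0 <= l' <= 1 -> dist x y <= r ->
  dist (W x y l) (W x' y' l')
  <= (1 - l') * dist x x' + l' * dist y y' + Rabs (l' - l) * r.
Proof.
  intros Hl Hl' Hr.
  pose proof (dist_tri _ (W x y l) (W x' y' l') (W x y l')) as H.
  pose proof (W4 X x x' y y' l' Hl') as H4.
  pose proof (W2 X x y l l' Hl Hl') as H2.
  rewrite Rabs_minus_sym in H2.
  pose proof (Rabs_pos (l' - l)).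
  nra.
Qed.

Lemma dist_le_double (x y p : X) (r : R) :
  dist x p <= r -> dist y p <= r -> dist x y <= 2 * r.
Proof.
  intros Hx Hy.
  pose proof (dist_tri _ x y p). rewrite (dist_sym _ p y) in H. lra.
Qed.

Lemma nonexpansive_dist_fix (C : X -> Prop) (S : X -> X) (x p : X) :
  nonexpansive_on C S -> Fix_on C S p -> C x -> dist (S x) p <= dist x p.
Proof.
  intros HS [Hp Sp] Hx. rewrite <- Sp at 1. now apply HS.
Qed.

End Distances.

(** * Quantitative recursive inequalities for real sequences *)

Section RealSequences.

Lemma sum_f_R0_unit_le (a : nat -> R) (n : nat) :
  (forall i, a i <= 1) -> sum_f_R0 a n <= INR n + 1.
Proof.
  intros Ha. induction n as [|n IH].
  - simpl. specialize (Ha 0%nat). lra.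
  - rewrite S_INR. simpl sum_f_R0. specialize (Ha (S n)). lra.
Qed.

Lemma sum_f_R0_mono (a : nat -> R) (m n : nat) :
  (forall i, 0 <= a i) -> (m <= n)%nat -> sum_f_R0 a m <= sum_f_R0 a n.
Proof.
  intros Ha Hmn. induction Hmn as [|n Hmn IH]; [lra|].
  simpl. specialize (Ha (S n)). lra.
Qed.

(** Induction on [m]: each step multiplies the exponential term by [1 - t <= exp (- t)], while the
    accumulated errors, being nonnegative, only shrink under the factor [1 - t]. The sums of [a] and
    [c] start one index apart because the recursion pairs [a (S n)] with [c n]. *)
Lemma contraction_recursion_bound (s a c : nat -> R) (L : R) (j m : nat) :
  (forall n, 0 <= s n) -> (forall n, 0 <= a n <= 1) -> (forall n, 0 <= c n) ->
  (forall n, s (S n) <= (1 - a (S n)) * s n + c n) ->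
  s (S j) <= L ->
  s (S j + m)%nat
  <= L * exp (sum_f_R0 a (S j) - sum_f_R0 a (S j + m))
     + (sum_f_R0 c (j + m) - sum_f_R0 c j).
Proof.
  intros Hs Ha Hc Hrec HL. induction m as [|m IH].
  - rewrite !Nat.add_0_r, !Rminus_diag, exp_0. lra.
  - rewrite !Nat.add_succ_r.
    pose proof (Hrec (S j + m)%nat) as Hstep.
    pose proof (Ha (S (S j + m))) as Ham.
    replace (sum_f_R0 a (S (S j + m)))
      with (sum_f_R0 a (S j + m) + a (S (S j + m))) by reflexivity.
    replace (sum_f_R0 c (S (j + m)))
      with (sum_f_R0 c (j + m) + c (S j + m)%nat) by reflexivity.
    set (A := sum_f_R0 a (S j)) in *.
    set (B := sum_f_R0 a (S j + m)) in *.
    set (D := sum_f_R0 c (j + m) - sum_f_R0 c j) in *.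
    set (t := a (S (S j + m))) in *.
    assert (HD : 0 <= D).
    { pose proof (sum_f_R0_mono c j (j + m) Hc ltac:(lia)). unfold D. lra. }
    replace (A - (B + t)) with ((A - B) + - t) by ring.
    rewrite exp_plus.
    pose proof (exp_ineq1_le (- t)) as He.
    pose proof (exp_pos (A - B)) as HE.
    assert (HL0 : 0 <= L) by (specialize (Hs (S j)); lra).
    assert (H1 : (1 - t) * s (S j + m)%nat
                 <= (1 - t) * (L * exp (A - B) + D))
      by (apply Rmult_le_compat_l; lra).
    assert (H2 : L * exp (A - B) * (1 - t) <= L * exp (A - B) * exp (- t))
      by (apply Rmult_le_compat_l; [apply Rmult_le_pos|]; lra).
    assert (H3 : 0 <= t * D) by (apply Rmult_le_pos; lra).
    change (S j + m)%nat with (S (j + m)) in *.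
    unfold D in *. nra.
Qed.

(** No sign condition is required: for a negative ceiling [Z.to_nat] returns 0, which still
    dominates [z]. *)
Lemma INR_to_nat_Zceil_ge (z : R) : z <= INR (Z.to_nat (Zceil z)).
Proof.
  rewrite INR_IZR_INZ.
  apply Rle_trans with (IZR (Zceil z)).
  - pose proof (Zceil_bound z). lra.
  - apply IZR_le. lia.
Qed.

(** In the argument of [theta], the summand [j + 2] pays for the [j + 2] terms of [a] up to index
    [S j], each at most 1. What remains is at least [ln (L / e)], which brings the exponential term
    down to [e]. *)
Lemma contraction_recursion_small (s a c : nat -> R) (L e : R)
    (theta : nat -> nat) (j n : nat) :
  0 < L -> 0 < e ->
  (forall i, 0 <= s i <= L) -> (forall i, 0 <= a i <= 1) ->
  (forall i, 0 <= c i) ->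
  (forall i, s (S i) <= (1 - a (S i)) * s i + c i) ->
  rate_of_divergence a theta ->
  (forall q, sum_f_R0 c (j + q) - sum_f_R0 c j <= e) ->
  (theta (j + 2 + Z.to_nat (Zceil (ln (L / e))))%nat <= n)%nat ->
  s n <= e + e.
Proof.
  intros HL He Hs Ha Hc Hrec Hdiv Htail Hn.
  set (Q := Z.to_nat (Zceil (ln (L / e)))) in *.
  assert (HQ : ln (L / e) <= INR Q) by apply INR_to_nat_Zceil_ge.
  assert (HA : INR j + 2 + INR Q <= sum_f_R0 a n).
  { pose proof (Hdiv (j + 2 + Q)%nat) as H.
    pose proof (sum_f_R0_mono a _ n (fun i => proj1 (Ha i)) Hn).
    rewrite !plus_INR in H. simpl (INR 2) in H. lra. }
  (* The [n + 1] terms up to [n] are at most 1 each and sum to at least [j + 2], so [n] lies beyond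
     the starting index of the unfolding. *)
  assert (Hjn : (S j <= n)%nat).
  { pose proof (sum_f_R0_unit_le a n (fun i => proj2 (Ha i))).
    pose proof (pos_INR Q).
    apply INR_le. rewrite S_INR. lra. }
  pose proof (contraction_recursion_bound s a c L j (n - S j)
    (fun i => proj1 (Hs i)) Ha Hc Hrec (proj2 (Hs _))) as H.
  replace (S j + (n - S j))%nat with n in H by lia.
  specialize (Htail (n - S j)%nat).
  assert (Hexp : exp (sum_f_R0 a (S j) - sum_f_R0 a n) <= e / L).
  { rewrite <- (exp_ln (e / L)) by (apply Rdiv_lt_0_compat; lra).
    pose proof (sum_f_R0_unit_le a (S j) (fun i => proj2 (Ha i))) as HSj.
    rewrite S_INR in HSj.
    replace (e / L) with (/ (L / e)) by (field; lra).
    rewrite ln_Rinv by (apply Rdiv_lt_0_compat; lra).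
    destruct (Rle_lt_or_eq_dec (sum_f_R0 a (S j) - sum_f_R0 a n) (- ln (L / e)))
      as [Hlt|Heq]; [lra| |].
    - left. now apply exp_increasing.
    - rewrite Heq. lra. }
  apply (Rmult_le_compat_l L) in Hexp; [|lra].
  replace (L * (e / L)) with e in Hexp by (field; lra).
  lra.
Qed.

Lemma series_Cauchy_modulus_tail (b : nat -> R) (phi : nat -> nat) (k n q : nat) :
  series_Cauchy_modulus b phi -> (phi k <= n)%nat ->
  sum_f_R0 b (n + q) - sum_f_R0 b n <= / (INR k + 1).
Proof.
  intros Hb Hn. specialize (Hb k n q Hn). cbn in Hb. unfold Rdist in Hb.
  eapply Rle_trans; [apply Rle_abs | exact Hb].
Qed.

(** A term is the difference of the partial sums at [n - 1] and [n]; the shift by one makes [n - 1]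
    reach [phi k]. *)
Lemma series_Cauchy_modulus_term (b : nat -> R) (phi : nat -> nat) (k n : nat) :
  series_Cauchy_modulus b phi -> (phi k + 1 <= n)%nat -> b n <= / (INR k + 1).
Proof.
  intros Hb Hn.
  pose proof (series_Cauchy_modulus_tail b phi k (n - 1) 1 Hb ltac:(lia)) as H.
  replace (n - 1 + 1)%nat with (S (n - 1)) in H by lia.
  simpl sum_f_R0 in H. replace (S (n - 1)) with n in H by lia. lra.
Qed.

End RealSequences.

(** * Boundedness and recursive inequalities for the iteration *)

Section AlternatingHalpernMann.
Context (X : W_hyperbolic_space) (C : X -> Prop) (T U : X -> X).
Context (x0 u p : X) (alpha beta : nat -> R) (x y : nat -> X) (M : R).
Context (C_convex : convex C).
Context (T_maps : maps_into C T).
Context (U_maps : maps_into C U).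
Context (T_nonexpansive : nonexpansive_on C T).
Context (U_nonexpansive : nonexpansive_on C U).
Context (x0_in_C : C x0).
Context (u_in_C : C u).
Context (alpha_01 : forall n : nat, 0 <= alpha n <= 1).
Context (beta_01 : forall n : nat, 0 <= beta n <= 1).
Context (iteration : alternating_Halpern_Mann T U x0 u alpha beta x y).
Context (p_Fix_T : Fix_on C T p).
Context (p_Fix_U : Fix_on C U p).
Context (x0_p : dist x0 p <= M).
Context (u_p : dist u p <= M).

Lemma iterates_in_C (n : nat) : C (x n) /\ C (y n).
Proof.
  destruct iteration as [Hx0 [Hy Hx]].
  assert (Cy : forall n, C (x n) -> C (y n))
    by (intros m Hm; rewrite Hy; apply C_convex; auto).
  induction n as [|n [IHx IHy]].
  - rewrite <- Hx0 in x0_in_C. auto.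
  - assert (C (x (S n))) by (rewrite Hx; apply C_convex; auto). auto.
Qed.

(** The ball of radius [M] about [p] contains [x0] and [u], is convex by (W1), and its points in [C]
    stay in it under [T] and [U]. *)
Lemma iterates_bounded (n : nat) : dist (x n) p <= M /\ dist (y n) p <= M.
Proof.
  destruct iteration as [Hx0 [Hy Hx]].
  assert (By : forall n, dist (x n) p <= M -> dist (y n) p <= M).
  { intros m Hm. rewrite Hy. apply dist_W_le; auto.
    pose proof (nonexpansive_dist_fix C T (x m) p T_nonexpansive p_Fix_T
      (proj1 (iterates_in_C m))). lra. }
  induction n as [|n [IHx IHy]].
  - rewrite <- Hx0 in x0_p. auto.
  - assert (dist (x (S n)) p <= M); [|auto].
    rewrite Hx. apply dist_W_le; auto.
    pose proof (nonexpansive_dist_fix C U (y n) p U_nonexpansive p_Fix_U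
      (proj2 (iterates_in_C n))). lra.
Qed.

Lemma dist_x_succ_bounded (n : nat) : dist (x n) (x (S n)) <= 2 * M.
Proof. apply dist_le_double with p; apply iterates_bounded. Qed.

(** The Halpern step yields the contraction factor: consecutive combinations share the anchor [u],
    so the endpoint weighted by [alpha (S n)] contributes [dist u u = 0]. *)
Lemma dist_y_succ (n : nat) :
  dist (y n) (y (S n))
  <= (1 - alpha (S n)) * dist (x n) (x (S n))
     + 2 * M * Rabs (alpha (S n) - alpha n).
Proof.
  destruct iteration as [_ [Hy _]]. rewrite !Hy.
  assert (Hr : dist (T (x n)) u <= 2 * M).
  { apply dist_le_double with p; auto.
    pose proof (nonexpansive_dist_fix C T (x n) p T_nonexpansive p_Fix_T
      (proj1 (iterates_in_C n))).
    pose proof (proj1 (iterates_bounded n)). lra. }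
  pose proof (dist_W_params _ _ (T (x (S n))) u _ _ _
    (alpha_01 n) (alpha_01 (S n)) Hr) as H.
  pose proof (T_nonexpansive _ _ (proj1 (iterates_in_C n))
    (proj1 (iterates_in_C (S n)))) as HT.
  rewrite (proj2 (dist_refl _ u u) eq_refl) in H.
  specialize (alpha_01 (S n)). nra.
Qed.

(** In the Mann step both endpoints move by at most [dist (y n) (y (S n))], hence so does their
    combination, up to the change of [beta]; the contraction factor is inherited from the Halpern
    step. *)
Lemma dist_x_succ_succ (n : nat) :
  dist (x (S n)) (x (S (S n)))
  <= (1 - alpha (S n)) * dist (x n) (x (S n))
     + (Rabs (alpha (S n) - alpha n) + Rabs (beta (S n) - beta n)) * (2 * M).
Proof.
  pose proof (dist_y_succ n) as Hys.
  destruct iteration as [_ [_ Hx]]. rewrite (Hx (S n)), (Hx n) at 1.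
  assert (Hr : dist (U (y n)) (y n) <= 2 * M).
  { apply dist_le_double with p; [|apply iterates_bounded].
    pose proof (nonexpansive_dist_fix C U (y n) p U_nonexpansive p_Fix_U
      (proj2 (iterates_in_C n))).
    pose proof (proj2 (iterates_bounded n)). lra. }
  pose proof (dist_W_params _ _ (U (y (S n))) (y (S n)) _ _ _
    (beta_01 n) (beta_01 (S n)) Hr) as H.
  pose proof (U_nonexpansive _ _ (proj2 (iterates_in_C n))
    (proj2 (iterates_in_C (S n)))) as HU.
  specialize (beta_01 (S n)). nra.
Qed.

End AlternatingHalpernMann.

Theorem proposition3p1 (X : W_hyperbolic_space) (C : X -> Prop) (T U : X -> X)
    (x0 u p : X) (alpha beta : nat -> R) (x y : nat -> X)
    (K : nat) (sigma2 sigma3 sigma4 : nat -> nat)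
    (C_nonempty : exists c : X, C c)
    (C_convex : convex C)
    (T_maps : maps_into C T) (U_maps : maps_into C U)
    (T_nonexpansive : nonexpansive_on C T)
    (U_nonexpansive : nonexpansive_on C U)
    (Fix_nonempty : exists q : X, Fix_on C T q /\ Fix_on C U q)
    (x0_in_C : C x0) (u_in_C : C u)
    (alpha_01 : forall n : nat, 0 <= alpha n <= 1)
    (beta_01 : forall n : nat, 0 <= beta n <= 1)
    (iteration : alternating_Halpern_Mann T U x0 u alpha beta x y)
    (p_Fix_T : Fix_on C T p) (p_Fix_U : Fix_on C U p)
    (K_ge_1 : (1 <= K)%nat)
    (K_ge_Mp : INR K >= Rmax (dist x0 p) (dist u p))
    (alpha_div : rate_of_divergence alpha sigma2)
    (alpha_var : series_Cauchy_modulus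
       (fun n => Rabs (alpha (S n) - alpha n)) sigma3)
    (beta_var : series_Cauchy_modulus
       (fun n => Rabs (beta (S n) - beta n)) sigma4) :
  asymptotically_regular_with_rate x (Gamma1 K sigma2 sigma3 sigma4) /\
  asymptotically_regular_with_rate y (Gamma2 K sigma2 sigma3 sigma4).
Proof.
  assert (HK : 1 <= INR K) by (apply (le_INR 1); exact K_ge_1).
  assert (Hx0p : dist x0 p <= INR K)
    by (pose proof (Rmax_l (dist x0 p) (dist u p)); lra).
  assert (Hup : dist u p <= INR K)
    by (pose proof (Rmax_r (dist x0 p) (dist u p)); lra).
  assert (HINR : forall k, INR (4 * K * (k + 1) - 1) + 1 = 4 * INR K * (INR k + 1)).
  { intro k. rewrite minus_INR by nia. rewrite !mult_INR, plus_INR. simpl. ring. }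
  assert (Hx : forall k n, (Gamma1 K sigma2 sigma3 sigma4 k <= n)%nat ->
                 dist (x n) (x (S n)) <= / (INR k + 1)).
  { intros k n Hn. pose proof (pos_INR k) as Hk.
    replace (/ (INR k + 1)) with (/ (2 * (INR k + 1)) + / (2 * (INR k + 1)))
      by (field; lra).
    (* With [L = 2K] and [e = 1/(2(k+1))], the quotient [L / e] is the [4K(k+1)] under the logarithm
       in [Gamma1]. *)
    apply (contraction_recursion_small (fun i => dist (x i) (x (S i))) alpha
      (fun i => (Rabs (alpha (S i) - alpha i) + Rabs (beta (S i) - beta i))
                * (2 * INR K)) (2 * INR K) (/ (2 * (INR k + 1))) sigma2
      (chi K sigma3 sigma4 (2 * k + 1)) n); auto.
    - lra.
    - apply Rinv_0_lt_compat. lra.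
    - intro i. split; [apply Rge_le, dist_pos|].
      apply (dist_x_succ_bounded X C T U x0 u p alpha beta x y); auto.
    - intro i. apply Rmult_le_pos; [|lra].
      apply Rplus_le_le_0_compat; apply Rabs_pos.
    - intro i. apply (dist_x_succ_succ X C T U x0 u p alpha beta x y); auto.
    - intro q.
      pose proof (series_Cauchy_modulus_tail _ _ (4 * K * (2 * k + 1 + 1) - 1)
        (chi K sigma3 sigma4 (2 * k + 1)) q alpha_var (Nat.le_max_l _ _)) as Ha.
      pose proof (series_Cauchy_modulus_tail _ _ (4 * K * (2 * k + 1 + 1) - 1)
        (chi K sigma3 sigma4 (2 * k + 1)) q beta_var (Nat.le_max_r _ _)) as Hb.
      rewrite HINR in Ha, Hb.
      rewrite <- !scal_sum, !plus_sum.
      (* At [2k+1] each of the two tails is at most [1/(8K(k+1))]; together, times [2K], they give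
         [e]. *)
      replace (/ (2 * (INR k + 1)))
        with (2 * INR K * (/ (4 * INR K * (INR (2 * k + 1) + 1))
                           + / (4 * INR K * (INR (2 * k + 1) + 1)))).
      + rewrite <- Rmult_minus_distr_l. apply Rmult_le_compat_l; lra.
      + rewrite plus_INR, mult_INR. simpl. field. lra.
    - replace (2 * INR K / / (2 * (INR k + 1))) with (INR (4 * K * (k + 1))).
      + unfold Gamma1 in Hn. lia.
      + rewrite !mult_INR, plus_INR. simpl. field. lra. }
  split; intros k n Hn; cbn; unfold Rdist; rewrite Rminus_0_r, Rabs_pos_eq
    by apply Rge_le, dist_pos.
  - auto.
  - unfold Gamma2 in Hn. pose proof (pos_INR k) as Hk.
    (* The error is split in halves: [Gamma1] at [2k+1] bounds the distance of the [x] iterates by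
       [1/(2(k+1))], and [sigma3] bounds the variation of [alpha] by [1/(4K(k+1))], which the factor
       [2K] turns into the other half. *)
    pose proof (Hx (2 * k + 1)%nat n ltac:(lia)) as Hxn.
    pose proof (series_Cauchy_modulus_term _ _ _ n alpha_var
      (Nat.le_trans _ _ _ (Nat.le_max_r _ _) Hn)) as Ha.
    cbn beta in Ha. rewrite HINR in Ha.
    assert (Hy : dist (y n) (y (S n))
      <= (1 - alpha (S n)) * dist (x n) (x (S n))
         + 2 * INR K * Rabs (alpha (S n) - alpha n))
      by (apply (dist_y_succ X C T U x0 u p alpha beta x y); auto).
    apply (Rmult_le_compat_l (2 * INR K)) in Ha; [|lra].
    replace (2 * INR K * / (4 * INR K * (INR k + 1)))
      with (/ (2 * (INR k + 1))) in Ha by (field; lra).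
    replace (INR (2 * k + 1) + 1) with (2 * (INR k + 1)) in Hxn
      by (rewrite plus_INR, mult_INR; simpl; ring).
    replace (/ (INR k + 1)) with (/ (2 * (INR k + 1)) + / (2 * (INR k + 1)))
      by (field; lra).
    pose proof (dist_pos _ (x n) (x (S n))).
    specialize (alpha_01 (S n)). nra.
Qed.
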